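(* Let $G_i:\mathcal R^p\rightrightarrows\mathcal R$, $G_i(x)=[L_i(x),R_i(x)]$, $i=1,\dots,n$, be compact-valued convex interval-valued functions, let $X\subset\mathcal R^p$ be non-empty, compact and convex, let $\lambda_0\in(0,1)$, and put $\bm\lambda^*=\lambda_0\bm 1_n\in\mathcal R^n$. If $(\bm x^*,\bm\lambda^* )\in\mathcal R^{np}\times\mathcal R^n$ is an optimal solution to the problem $$\min_{\bm x}\ f(\bm x,\bm\lambda)=\sum_{i=1}^n\big(\lambda_iL_i(x_i)+(1-\lambda_i)R_i(x_i)\big)\quad\text{s.t.}\quad x_i=x_j,\ x_i\in X,\ \lambda_i=\lambda_j\quad (i,j=1,\dots,n)$$ with $\bm\lambda=[\lambda_1,\dots,\lambda_n]^\top=\lambda_0\bm 1_n$, then $\bm x^*$ is a Pareto optimal solution to the distributed interval optimization problem $$\min_{\bm x}\ G(\bm x)=\sum_{i=1}^nG_i(x_i)\quad\text{s.t.}\quad x_i=x_j,\ x_i\in X\quad(i,j=1,\dots,n).$$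
   Context: Here $\bm x=[x_1^\top,\dots,x_n^\top]^\top\in\mathcal R^{np}$ with $x_i\in\mathcal R^p$, and $\bm 1_n$ is the all-ones vector. Each $G_i(x)=[L_i(x),R_i(x)]$ is a non-empty compact interval in $\mathcal R$; sums of intervals are Minkowski sums, so $G(\bm x)=[\sum_iL_i(x_i),\sum_iR_i(x_i)]$. For compact intervals, $[a_L,a_R]\leqq[b_L,b_R]$ means $a_L\le b_L$ and $a_R\le b_R$. $G_i$ is convex if $G_i(\alpha x+(1-\alpha)y)\leqq\alpha G_i(x)+(1-\alpha)G_i(y)$ for all $x,y\in\mathcal R^p$, $\alpha\in[0,1]$. For the interval problem of minimizing $G$ over a feasible set $\Omega$, a point $\bm x^*\in\Omega$ is a Pareto optimal solution if, whenever $\bar{\bm x}\in\Omega$ satisfies $G(\bar{\bm x})\leqq G(\bm x^* )$, one also has $G(\bm x^* )\leqq G(\bar{\bm x})$. *)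

(* Defs.v *)
From mathcomp Require Import all_boot all_order all_algebra.
From mathcomp Require Import all_classical all_reals all_analysis.

Set Implicit Arguments.
Unset Strict Implicit.
Unset Printing Implicit Defensive.

Import Order.TTheory GRing.Theory Num.Theory.
Import numFieldNormedType.Exports.

Local Open Scope classical_set_scope.
Local Open Scope ring_scope.

Section Intervals.
Context {R : realType}.
Implicit Types A B : set R.

Definition minkowski_add A B : set R := [set a + b | a in A & b in B].

Definition minkowski_sum n (A : 'I_n -> set R) : set R :=
  \big[minkowski_add/[set 0]]_(i < n) A i.

Definition set_scale (c : R) A : set R := [set c * a | a in A].

(* False unless A and B are both non-empty compact intervals; the endpoints are
   then determined by the sets. *)
Definition itv_le A B : Prop :=
  exists aL aR bL bR : R,
    [/\ aL <= aR, bL <= bR, A = `[aL, aR]%classic, B = `[bL, bR]%classic &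
        aL <= bL /\ aR <= bR].

Definition itv_convex p (F : 'cV[R]_p -> set R) : Prop :=
  forall (x y : 'cV[R]_p) (a : R), 0 <= a <= 1 ->
    itv_le (F (a *: x + (1 - a) *: y))
           (minkowski_add (set_scale a (F x)) (set_scale (1 - a) (F y))).

End Intervals.

Section Optimality.
Context {R : realType} {T : Type}.

Definition optimal_solution (Omega : set T) (f : T -> R) (z : T) : Prop :=
  Omega z /\ forall w, Omega w -> f z <= f w.

Definition pareto_optimal (Omega : set T) (F : T -> set R) (z : T) : Prop :=
  Omega z /\ forall w, Omega w -> itv_le (F w) (F z) -> itv_le (F z) (F w).

End Optimality.

(* R^(np), with the dimension written as p + ... + p so that [submxcol x i] is
   the i-th block x_i in R^p of the stacked vector x. *)
Notation stacked R n p := 'cV[R]_(\sum_(i < n) p).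

Section DistributedProblem.
Context {R : realType} {n p : nat}.
Implicit Types (X : set 'cV[R]_p) (x : stacked R n p) (lam : 'cV[R]_n).

Definition block x (i : 'I_n) : 'cV[R]_p := @submxcol R n (fun=> p) 1 x i.

Definition consensus_set X : set (stacked R n p) :=
  [set x | (forall i j, block x i = block x j) /\ (forall i, X (block x i))].

Definition total_itv (G : 'I_n -> 'cV[R]_p -> set R) x : set R :=
  minkowski_sum (fun i => G i (block x i)).

Definition scalar_objective (Lo Up : 'I_n -> 'cV[R]_p -> R)
    (z : stacked R n p * 'cV[R]_n) : R :=
  \sum_(i < n) (z.2 i 0 * Lo i (block z.1 i)
                + (1 - z.2 i 0) * Up i (block z.1 i)).

(* The weight vector is prescribed: only x varies in the minimization. *)
Definition scalar_feasible X lam0 : set (stacked R n p * 'cV[R]_n) :=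
  [set z : stacked R n p * 'cV[R]_n |
    [/\ consensus_set X z.1, forall i j, z.2 i 0 = z.2 j 0
      & z.2 = lam0]].

End DistributedProblem.

(* Main.v *)
(* With common weights lambda0 and 1 - lambda0, the scalar objective is
   lambda0 * L(x) + (1 - lambda0) * U(x) for total_itv G x = [L(x), U(x)].
   Both weights are positive, so a feasible w that is at least as good as xstar
   in both endpoints cannot be strictly better in either. *)

Require Import Defs.
From mathcomp Require Import all_boot all_order all_algebra.
From mathcomp Require Import all_classical all_reals all_analysis.
From mathcomp Require Import lra.

Set Implicit Arguments.
Unset Strict Implicit.
Unset Printing Implicit Defensive.

Import Order.TTheory GRing.Theory Num.Theory.
Import numFieldNormedType.Exports.

Local Open Scope classical_set_scope.
Local Open Scope ring_scope.

Lemma minkowski_add_itvcc (R : realType) (a b c d : R) :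
  a <= b -> c <= d -> minkowski_add `[a, b] `[c, d] = `[a + c, b + d]%classic.
Proof.
move=> ab cd; apply/seteqP; split=> x /=.
  by move=> [u + [v + <-]]; rewrite /= !in_itv /= => /andP[? ?] /andP[? ?]; lra.
rewrite in_itv /= => /andP[acx xbd].
(* To split [x] as [u + v], give [v] its largest value [d] if the remainder [x - d] is still at
   least [a]; otherwise [u = a], and [x - a] lies between [c] and [d]. *)
have [axd|dxa] := leP a (x - d).
  exists (x - d); first by rewrite /= in_itv /=; lra.
  by exists d; [rewrite /= in_itv /=; lra | lra].
exists a; first by rewrite /= in_itv /=; lra.
by exists (x - a); [rewrite /= in_itv /=; lra | lra].
Qed.

Lemma minkowski_sum_itvcc (R : realType) (n : nat) (L U : 'I_n -> R) :
  (forall i, L i <= U i) ->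
  minkowski_sum (fun i => `[L i, U i]%classic) =
  `[\sum_(i < n) L i, \sum_(i < n) U i]%classic.
Proof.
move=> LU; rewrite /minkowski_sum.
(* The order of the partial sums of endpoints is carried through the induction, because
   [minkowski_add_itvcc] applies to intervals with ordered endpoints. The empty sum is the
   degenerate interval from 0 to 0. *)
suff [] : \big[minkowski_add/[set 0]]_(i < n) `[L i, U i]%classic =
    `[\sum_(i < n) L i, \sum_(i < n) U i]%classic /\
    \sum_(i < n) L i <= \sum_(i < n) U i by [].
elim/big_ind3: _ => [|A a b B c d [-> ab] [-> cd]|i _]; last by split.
  by rewrite set_itv1.
by rewrite minkowski_add_itvcc // lerD.
Qed.

Lemma sub_itvcc (R : realType) (a b c d : R) :
  a <= b -> `[a, b] `<=` `[c, d] -> c <= a /\ b <= d.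
Proof.
move=> ab sub; split.
- by have /= := sub a; rewrite !in_itv /= lexx ab => /(_ isT) /andP[].
- by have /= := sub b; rewrite !in_itv /= lexx ab => /(_ isT) /andP[].
Qed.

(** The endpoints in [itv_le] are existentially quantified. A non-empty closed interval determines
    its endpoints, by inclusion both ways, so the witnesses must be the given ones. *)
Lemma itv_le_itvcc (R : realType) (a b c d : R) : a <= b -> c <= d ->
  itv_le `[a, b]%classic `[c, d]%classic <-> a <= c /\ b <= d.
Proof.
move=> ab cd; split=> [|acbd]; last by exists a, b, c, d.
move=> [a' [b' [c' [d' [ab' cd' /seteqP[abS abS'] /seteqP[cdS cdS'] [ac' bd']]]]]].
have [? ?] := sub_itvcc ab abS; have [? ?] := sub_itvcc ab' abS'.
have [? ?] := sub_itvcc cd cdS; have [? ?] := sub_itvcc cd' cdS'.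
by split; lra.
Qed.

Lemma scalar_objective_const (R : realType) (n p : nat)
    (Lo Up : 'I_n -> 'cV[R]_p -> R) (x : stacked R n p) (l : R) :
  scalar_objective Lo Up (x, const_mx l) =
  l * (\sum_(i < n) Lo i (block x i)) + (1 - l) * (\sum_(i < n) Up i (block x i)).
Proof.
by rewrite !mulr_sumr -big_split; apply: eq_bigr => i _; rewrite /= mxE.
Qed.

Theorem lemma7 (R : realType) (n p : nat)
    (G : 'I_n -> 'cV[R]_p -> set R) (Lo Up : 'I_n -> 'cV[R]_p -> R)
    (X : set 'cV[R]_p) (lambda0 : R) (xstar : stacked R n p)
    (hLoUp : forall i x, Lo i x <= Up i x)
    (hG : forall i x, G i x = `[Lo i x, Up i x]%classic)
    (hGconvex : forall i, itv_convex (G i))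
    (hX0 : X !=set0) (hXcompact : compact X) (hXconvex : convex_set X)
    (hlambda0 : 0 < lambda0 < 1)
    (hopt : optimal_solution (scalar_feasible X (const_mx lambda0))
              (scalar_objective Lo Up) (xstar, const_mx lambda0)) :
  pareto_optimal (consensus_set X) (total_itv G) xstar.
Proof.
have totE x : total_itv G x =
    `[\sum_(i < n) Lo i (block x i), \sum_(i < n) Up i (block x i)]%classic.
  rewrite -minkowski_sum_itvcc // /total_itv.
  by congr minkowski_sum; apply/funext => i.
have sumLU x : \sum_(i < n) Lo i (block x i) <= \sum_(i < n) Up i (block x i).
  exact: ler_sum.
have [[xstarX _ _] xstar_min] := hopt; split=> // w wX.
rewrite !totE !itv_le_itvcc // => -[Lle Ule].
have /xstar_min : scalar_feasible X (const_mx lambda0) (w, const_mx lambda0).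
  by split=> // i j; rewrite !mxE.
rewrite !scalar_objective_const => opt; have /andP[l0 l1] := hlambda0.
(* With [l] the common weight, [opt] says that [l] times the gap in lower endpoints plus [1 - l]
   times the gap in upper endpoints is at most 0. Both gaps are nonnegative by [Lle] and [Ule], so a
   positive one would make this sum positive. *)
by split; nra.
Qed.
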